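(* For $d,n\in\mathbb{N}$, let $h_c=h_c(d,n)$ be the smallest positive integer with the following property: whenever $\mathcal{F}_1,\dots,\mathcal{F}_{h_c}$ are collections of axis-parallel boxes in $\mathbb{R}^d$ such that every colorful $h_c$-tuple is $n$-pierceable, there exists $i\in[h_c]$ such that $\mathcal{F}_i$ is $n$-pierceable. Then (1) $h_c(1,n)=n+1$ for all $n\in\mathbb{N}$, and (2) $h_c(d,2)=3d$ for all $d\in\mathbb{N}$.
   Context: An axis-parallel box in $\mathbb{R}^d$ is a set $[\alpha_1,\beta_1]\times\dots\times[\alpha_d,\beta_d]$ with $\alpha_j\le\beta_j$ real (for $d=1$, a closed interval). A family $\mathcal{F}$ of subsets of $\mathbb{R}^d$ is $n$-pierceable if there is a set $A\subseteq\mathbb{R}^d$ with $|A|\le n$ such that $F\cap A\neq\emptyset$ for every $F\in\mathcal{F}$. Given families $\mathcal{F}_1,\dots,\mathcal{F}_m$, a colorful $t$-tuple is a tuple $(C_1,\dots,C_t)$ such that for each $j\in[t]$ there is $i_j\in[m]$ with $C_j\in\mathcal{F}_{i_j}$, and $i_j\neq i_k$ for $j\neq k$. $[m]=\{1,\dots,m\}$. *)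

(* Defs.v *)
From Stdlib Require Import Reals List.
From mathcomp Require Import all_boot.
Set Implicit Arguments. Unset Strict Implicit. Unset Printing Implicit Defensive.

Open Scope R_scope.

Definition point (d : nat) := 'I_d -> R.

Definition is_box (d : nat) (B : point d -> Prop) : Prop :=
  exists a b : point d, (forall j, a j <= b j) /\
    (forall x, B x <-> (forall j, a j <= x j /\ x j <= b j)).

Definition family (d : nat) := (point d -> Prop) -> Prop.

Definition family_of_boxes (d : nat) (F : family d) : Prop :=
  forall B, F B -> is_box B.

Definition pierceable (d n : nat) (F : family d) : Prop :=
  exists A : list (point d), (length A <= n)%nat /\
    forall B, F B -> exists x, In x A /\ B x.

Definition colorful_pierceable (d n m t : nat) (Fs : 'I_m -> family d) : Prop :=
  forall (idx : 'I_t -> 'I_m) (C : 'I_t -> (point d -> Prop)),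
    injective idx -> (forall j, Fs (idx j) (C j)) ->
    pierceable n (fun B => exists j, B = C j).

Definition hc_property (d n h : nat) : Prop :=
  forall Fs : 'I_h -> family d,
    (forall i, family_of_boxes (Fs i)) ->
    colorful_pierceable n h Fs ->
    exists i, pierceable n (Fs i).

Definition is_hc (d n h : nat) : Prop :=
  (0 < h)%N /\ hc_property d n h /\
  (forall m, (0 < m)%N -> (m < h)%N -> ~ hc_property d n m).

(* Main.v *)
From Stdlib Require Import Reals List.
From mathcomp Require Import all_boot.
From mathcomp Require Import zify.
From Stdlib Require Import Lra Lia Classical ClassicalEpsilon.
Require Import Defs.
Set Implicit Arguments. Unset Strict Implicit. Unset Printing Implicit Defensive.

(** Upper bounds.  Two points piercing a family of boxes may be taken at opposite corners
    of the box spanned, in each coordinate, by the smallest right endpoint and the largest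
    left endpoint.  With [3d] colours, [2d] colours
    are spent greedily on the families that are most extreme on the [2d] sides.  Each of
    the other [d] families, not being 2-pierceable, contains for every diagonal [e] a box
    missing both ends of it, which forbids all [x] with [x j (+) x k = e j (+) e k] for
    some [j, k].  Choosing [e] among the diagonals that are still allowed halves this
    affine subset of [F_2^d] at each step; as it is invariant under negation, [d] steps
    empty it.  For intervals, the colour with the leftmost right endpoint is removed and
    the other colours are restricted to the intervals beyond it, which yields a rainbow
    set of pairwise disjoint intervals.

    Lower bounds.  For [d = 1] take [n] copies of [n + 1] distinct points.  For [n = 2]
    take, in each coordinate, two families of three parallel strips, and [d - 1] copies of
    a family encoding an unbalanced signed cycle on the [d] coordinates: a colourful tuple
    always misses an edge of the cycle. *)

(** * Approximate infima and separated choices *)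

(* [v] is arbitrary when [E] is empty or unbounded below. *)
Lemma exists_real_inf (E : R -> Prop) :
  exists v : R, forall t, (forall y, E y -> t <= y) ->
    (forall y, E y -> v <= y) /\ ((exists y, E y) -> t <= v).
Proof.
case: (classic ((exists y, E y) /\ exists t, forall y, E y -> t <= y)).
- move=> [[y0 Ey0] [t0 ht0]].
  have [| |m [m1 m2]] := completeness (fun x => E (- x)).
  + by exists (- t0) => x Ex; move: (ht0 _ Ex); lra.
  + by exists (- y0); rewrite Ropp_involutive.
  exists (- m) => t ht; split.
  + move=> y Ey; have : - y <= m by apply: m1; rewrite Ropp_involutive.
    lra.
  + move=> _; have : m <= - t by apply: m2 => x Ex; move: (ht _ Ex); lra.
    lra.
- move=> H; exists 0 => t ht; split=> [y Ey|Ey]; case: H.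
  + by split; [exists y | exists t].
  + by split=> //; exists t.
Qed.

(** An infimum of [h] need not be attained; a member of [U] low enough for finitely many thresholds
    replaces it. The lower of two witnesses keeps every threshold already met. *)
Lemma common_lower_witness (X : Type) (U : X -> Prop) (h : X -> R) (ts : list R) :
  (exists x, U x) ->
  exists x, U x /\ forall t, In t ts -> (exists y, U y /\ h y < t) -> h x < t.
Proof.
move=> [x0 Ux0]; elim: ts => [|t ts [x [Ux hx]]]; first by exists x0.
case: (classic (exists y, U y /\ h y < t)) => [[y [Uy hy]]|no].
- case: (Rle_lt_dec (h x) (h y)) => le.
  + by exists x; split=> // u [<- _|/hx //]; lra.
  + exists y; split=> // u [<- //|/hx hu /hu]; lra.
- by exists x; split=> // u [<- //|/hx].
Qed.

Lemma common_separated_pair (X I : Type) (U V : X -> Prop) (lo hi : X -> R)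
    (B : I -> X) (rs : list I) :
  (exists C, U C) -> (exists D, V D) ->
  (forall i, In i rs -> forall t, hi (B i) < t -> exists C, U C /\ hi C < t) ->
  (forall i, In i rs -> forall t, t < lo (B i) -> exists D, V D /\ t < lo D) ->
  exists C D, [/\ U C, V D & forall i, In i rs ->
    ((exists C', U C' /\ hi C' < lo (B i)) -> hi C < lo (B i) /\ hi C < lo D) /\
    ((exists D', V D' /\ hi (B i) < lo D') -> hi (B i) < lo D /\ hi C < lo D)].
Proof.
move=> neU neV hU hV.
(* [C0] is provisional: [D] is pushed beyond it where possible, and only then is [C] chosen to the
   left of [D]. *)
have [C0 [UC0 hC0]] := common_lower_witness hi [seq lo (B i) | i <- rs] neU.
have [D [VD hD]] := common_lower_witness (fun x => - lo x)
  ((- hi C0) :: [seq - hi (B i) | i <- rs]) neV.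
have [C [UC hC]] := common_lower_witness hi
  (lo D :: [seq lo (B i) | i <- rs]) neU.
exists C, D; split=> // i ri; split.
- move=> beat.
  have h0 : hi C0 < lo (B i) by apply: hC0 => //; apply: in_map ri.
  split; first by apply: hC => //; right; apply: (in_map (fun i => lo (B i))).
  apply: hC; first by left.
  exists C0; split=> //.
  have : - lo D < - hi C0.
    apply: hD; first by left.
    have [D' [VD' hD']] := hV _ ri _ h0.
    by exists D'; split=> //; lra.
  lra.
- move=> [D' [VD' hD']].
  have h0 : hi (B i) < lo D.
    have : - lo D < - hi (B i).
      apply: hD; first by right; apply: (in_map (fun i => - hi (B i))).
      by exists D'; split=> //; lra.
    lra.
  split=> //; apply: hC; first by left.
  exact: hU ri _ h0.
Qed.

(** * Greedy choice of extreme colours *)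

Lemma seq_minimal (I : eqType) (le : I -> I -> Prop) (s : seq I) :
  (forall i k, le i k \/ le k i) ->
  (forall i k l, le i k -> le k l -> le i l) ->
  s != [::] -> exists2 i, i \in s & forall k, k \in s -> le i k.
Proof.
move=> tot tr; have refl i : le i i by case: (tot i i).
elim: s => // a [|b s] IH _.
  by exists a => [|k]; rewrite mem_seq1 // => /eqP->.
have [i si hi] := IH isT.
case: (tot a i) => [lai|lia].
- exists a => [|k]; rewrite inE ?eqxx // => /orP[/eqP-> //|/hi].
  exact: tr.
- by exists i => [|k]; rewrite inE ?si ?orbT // => /orP[/eqP->|/hi].
Qed.

(** Each slot takes a minimal element of what is left of [A]. An element never taken was available
    at every step, so every slot compared it. *)
Lemma greedy_slots (S : eqType) (I : finType) (le : S -> I -> I -> Prop)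
    (ss : seq S) (A : {set I}) (i0 : I) :
  (forall s i k, le s i k \/ le s k i) ->
  (forall s i k l, le s i k -> le s k l -> le s i l) ->
  uniq ss -> (size ss <= #|A|)%N ->
  exists c : S -> I, [/\ {in ss &, injective c},
    (forall s, s \in ss -> c s \in A) &
    forall s i, s \in ss -> i \in A -> i \notin [seq c t | t <- ss] ->
      le s (c s) i].
Proof.
move=> tot tr; elim: ss A => [|s ss IH] A /=; first by exists (fun _ => i0).
move=> /andP[sss us] hA.
have neA : enum A != [::] by rewrite -size_eq0 -cardE -lt0n (leq_trans _ hA).
have [i iA hi] := seq_minimal (tot s) (tr s) neA; rewrite mem_enum in iA.
have [|c [cinj cA cle]] := IH (A :\ i) us.
  by move: hA; rewrite (cardsD1 i A) iA add1n ltnS.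
have ni t : t \in ss -> c t == i = false.
  by move=> /cA; rewrite !inE => /andP[/negbTE].
have ns t : t \in ss -> t == s = false.
  by move=> tss; apply: contraNF sss => /eqP<-.
exists (fun t => if t == s then i else c t); split.
- move=> t u; rewrite !inE => /orP[/eqP->|tss] /orP[/eqP->|uss]; rewrite ?eqxx ?ns //.
  + by move=> /esym/eqP; rewrite ni.
  + by move=> /eqP; rewrite ni.
  + exact: cinj.
- move=> t; rewrite inE => /orP[/eqP->|tss]; rewrite ?eqxx ?ns //.
  by move: (cA _ tss); rewrite !inE => /andP[].
- have -> : [seq (if t == s then i else c t) | t <- ss] = [seq c t | t <- ss].
    by apply/eq_in_map => t /ns ->.
  move=> t k; rewrite !inE => /orP[/eqP->|tss] kA; rewrite eqxx negb_or => /andP[ki kc].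
  + by apply: hi; rewrite mem_enum.
  + by rewrite ns //; apply: cle => //; rewrite !inE ki.
Qed.

(** * Affine subsets of F_2^d *)

Definition xor3 d (x y z : {ffun 'I_d -> bool}) : {ffun 'I_d -> bool} :=
  [ffun j => x j (+) y j (+) z j].

Definition flip d (x : {ffun 'I_d -> bool}) : {ffun 'I_d -> bool} :=
  [ffun j => ~~ x j].

(** Closure under [xor3] makes [S] an affine subspace, or empty. If some [y] in [S] violates the
    relation satisfied by [e], translation by [e + y] maps the violators injectively into the rest
    of [S]. *)
Lemma halve_affine d (S : {set {ffun 'I_d -> bool}}) e j k :
  (forall x y z, x \in S -> y \in S -> z \in S -> xor3 x y z \in S) ->
  e \in S ->
  (#|[set x in S | x j (+) x k != e j (+) e k]| * 2 <= #|S|)%N.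
Proof.
move=> cS eS; set S' := [set x in S | _].
have [->|[y yS']] := set_0Vmem S'; first by rewrite cards0.
have /andP[yS yjk] : (y \in S) && (y j (+) y k != e j (+) e k) by rewrite inE in yS'.
have inj : injective (xor3 e y).
  move=> a b /ffunP E; apply/ffunP => l; move: (E l); rewrite !ffunE.
  exact: addbI.
have S'S : S' \subset S by apply/subsetP => x; rewrite inE => /andP[].
have im : [set xor3 e y x | x in S'] \subset S :\: S'.
  apply/subsetP => _ /imsetP[x xS' ->].
  have xS := subsetP S'S _ xS'; rewrite !inE (cS _ _ _ eS yS xS) /= negbK andbT.
  move: xS' yjk; rewrite inE xS /= !ffunE.
  by case: (x j) (x k) (y j) (y k) (e j) (e k) => [] [] [] [] [] [].
rewrite muln2 -addnn -{2}(card_imset (mem S') inj) -(cardsID S' S) (setIidPr S'S) leq_add2l.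
exact: subset_leq_card.
Qed.

(* Each colour imposes a relation [x j (+) x k = const] violated by a point of the
   current solution set, so the affine solution set at least halves. *)
Lemma rainbow_unsatisfiable d (I : eqType) (X : Type) (X0 : X)
    (P : I -> X -> Prop) (bt : X -> 'I_d -> bool -> Prop) (rs : seq I) :
  uniq rs ->
  (forall i (e : {ffun 'I_d -> bool}), i \in rs -> exists B, P i B /\
     exists j k, bt B j (e j) /\ bt B k (~~ e k)) ->
  exists (f : I -> X) (S : {set {ffun 'I_d -> bool}}),
   [/\ forall i, i \in rs -> P i (f i),
       forall x y z, x \in S -> y \in S -> z \in S -> xor3 x y z \in S,
       forall x, x \in S -> flip x \in S,
       (#|S| * 2 ^ size rs <= 2 ^ d)%N &
       forall x : {ffun 'I_d -> bool}, x \notin S -> exists2 i, i \in rs &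
         exists j k, bt (f i) j (x j) /\ bt (f i) k (~~ x k)].
Proof.
elim: rs => [|i rs IH] /=.
  move=> _ _; exists (fun _ => X0), setT; split=> // [x y z|x||x]; rewrite ?inE //.
  by rewrite muln1 cardsT card_ffun card_bool card_ord.
move=> /andP[irs urs] H.
have [|f [S [fP cS flS szS badS]]] := IH urs.
  by move=> k e krs; apply: H; rewrite inE krs orbT.
have ni k : k \in rs -> k == i = false by move=> krs; apply: contraNF irs => /eqP<-.
have iin : i \in i :: rs by rewrite inE eqxx.
have [S0|[e eS]] := set_0Vmem S.
- have [B [PB _]] := H i [ffun=> true] iin.
  exists (fun k => if k == i then B else f k), S; split=> //.
  + by move=> k; rewrite inE => /orP[/eqP->|krs]; rewrite ?eqxx ?ni //; apply: fP.
  + by rewrite S0 cards0.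
  + move=> x /badS[k krs bad]; exists k; first by rewrite inE krs orbT.
    by rewrite ni.
have [B [PB [j [k [bj bk]]]]] := H i e iin.
exists (fun k => if k == i then B else f k),
  [set x in S | x j (+) x k != e j (+) e k]; split.
- by move=> l; rewrite inE => /orP[/eqP->|krs]; rewrite ?eqxx ?ni //; apply: fP.
- move=> x y z; rewrite !inE => /andP[xS hx] /andP[yS hy] /andP[zS hz].
  rewrite cS //= !ffunE; move: hx hy hz.
  by case: (x j) (x k) (y j) (y k) (z j) (z k) (e j) (e k) => [] [] [] [] [] [] [] [].
- move=> x; rewrite !inE => /andP[xS hx]; rewrite flS //= !ffunE; move: hx.
  by case: (x j) (x k) (e j) (e k) => [] [] [] [].
- rewrite expnS mulnA; apply: leq_trans szS; rewrite leq_mul2r halve_affine ?orbT //.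
- move=> x; rewrite inE negb_and => /orP[/badS[l lrs bad]|].
    exists l; first by rewrite inE lrs orbT.
    by rewrite ni.
  rewrite negbK => /eqP xe; exists i => //; rewrite eqxx.
  (* A discarded [x] agrees with [e] at both [j] and [k], or differs at both; in the second case [j]
     and [k] exchange roles. *)
  have [xj|xj] := eqVneq (x j) (e j).
    exists j, k; rewrite xj; split=> //; suff -> : x k = e k by [].
    by move: xe; rewrite xj => /addbI.
  have xj' : e j = ~~ x j by case: (x j) (e j) xj => [] [].
  exists k, j; rewrite -xj'; split=> //; suff -> : x k = ~~ e k by [].
  by move: xe; rewrite xj'; case: (x j) (x k) (e k) => [] [] [].
Qed.

(** After [d] halvings at most one point is left, and [flip] would map it to a second one, as
    [0 < d]. *)
Lemma rainbow_bad_everywhere d (I : eqType) (X : Type) (X0 : X)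
    (P : I -> X -> Prop) (bt : X -> 'I_d -> bool -> Prop) (rs : seq I) :
  (0 < d)%N -> size rs = d -> uniq rs ->
  (forall i (e : {ffun 'I_d -> bool}), i \in rs -> exists B, P i B /\
     exists j k, bt B j (e j) /\ bt B k (~~ e k)) ->
  exists f : I -> X, (forall i, i \in rs -> P i (f i)) /\
    forall x : {ffun 'I_d -> bool}, exists2 i, i \in rs &
      exists j k, bt (f i) j (x j) /\ bt (f i) k (~~ x k).
Proof.
move=> d0 szr urs /(rainbow_unsatisfiable X0 urs)[f [S [fP _ flS szS badS]]].
exists f; split=> // x; apply: badS; apply/negP => xS.
rewrite szr in szS.
have : (#|S| <= 1)%N.
  have p2 : (0 < 2 ^ d)%N by rewrite expn_gt0.
  by rewrite -(leq_pmul2r p2) mul1n.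
apply/negP; rewrite -ltnNge (cardsD1 x) xS add1n ltnS lt0n cards_eq0.
apply/set0Pn; exists (flip x); rewrite !inE flS // andbT.
apply/eqP => /ffunP /(_ (Ordinal d0)); rewrite ffunE; by case: (x _).
Qed.

(** * Endpoints of boxes and extremeness of families *)

Definition bounds_spec d (B : point d -> Prop) (ab : point d * point d) : Prop :=
  (forall j, ab.1 j <= ab.2 j) /\
  (forall x, B x <-> (forall j, ab.1 j <= x j /\ x j <= ab.2 j)).

Definition bounds d (B : point d -> Prop) : point d * point d :=
  epsilon (inhabits (fun _ => 0, fun _ => 0)) (bounds_spec B).

Definition lo d (j : 'I_d) (B : point d -> Prop) : R := (bounds B).1 j.
Definition hi d (j : 'I_d) (B : point d -> Prop) : R := (bounds B).2 j.

Lemma is_boxP d (B : point d -> Prop) : is_box B ->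
  forall x, B x <-> (forall j, lo j B <= x j /\ x j <= hi j B).
Proof.
move=> [a [b ab]].
have : bounds_spec B (bounds B) by apply: epsilon_spec; exists (a, b).
by case.
Qed.

(* The side [true] is the right one. *)
Definition beats d (s : bool) (j : 'I_d) (C B : point d -> Prop) : Prop :=
  if s then hi j B < lo j C else hi j C < lo j B.

Definition key d (s : bool) (j : 'I_d) (B : point d -> Prop) : R :=
  if s then - lo j B else hi j B.

(** This compares the infima of [key] over [F] and [G] by thresholds, so that unbounded families and
    unattained infima are covered as well. *)
Definition more_extreme d (s : bool) (j : 'I_d) (F G : family d) : Prop :=
  forall t, (exists B, G B /\ key s j B < t) -> exists C, F C /\ key s j C < t.

Lemma more_extreme_total d s j (F G : family d) :
  more_extreme s j F G \/ more_extreme s j G F.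
Proof.
case: (classic (more_extreme s j F G)) => [|no]; [by left | right].
move=> t [C [FC hC]]; apply: NNPP => noB; apply: no => u [B [GB hB]].
exists C; split=> //; apply: Rnot_le_lt => hu; apply: noB; exists B; split=> //; lra.
Qed.

Lemma more_extreme_trans d s j (F G H : family d) :
  more_extreme s j F G -> more_extreme s j G H -> more_extreme s j F H.
Proof. by move=> FG GH t /GH/FG. Qed.

(** Up to sign, [v] is the infimum of the keys of [F]. Being unbeaten bounds [v] by one end of [B],
    extremeness of [F] by the other. If the keys are unbounded below, every [B] is beaten. *)
Lemma slot_value d s j (F : family d) : (exists C, F C) ->
  exists v, forall (G : family d) B, more_extreme s j F G -> G B ->
    ~ (exists C, F C /\ beats s j C B) -> lo j B <= v /\ v <= hi j B.
Proof.
move=> [C0 FC0].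
have [v hv] := exists_real_inf (fun y => exists C, F C /\ y = key s j C).
exists (if s then - v else v) => G B FG GB nb.
have [] := hv (if s then - hi j B else lo j B).
  move=> _ [C [FC ->]]; apply: Rnot_lt_le => lt; apply: nb; exists C; split=> //.
  by move: lt; rewrite /beats /key; case: s {FG hv} => lt; lra.
move=> vle tle.
have {}tle : (if s then - hi j B else lo j B) <= v.
  by apply: tle; exists (key s j C0), C0.
have vk : v <= key s j B.
  apply: Rnot_lt_le => lt; have [|C [FC hC]] := FG v; first by exists B.
  by have := vle (key s j C) (ex_intro _ C (conj FC erefl)); lra.
by move: tle vk; rewrite /key; case: s {FG hv nb vle} => ? ?; lra.
Qed.

Lemma not_pierceable_inhabited d n (F : family d) :
  ~ pierceable n F -> exists B, F B.
Proof.
move=> np; apply: NNPP => no; apply: np; exists nil; split=> // B FB.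
by case: no; exists B.
Qed.

(** * Two points: the upper bound [3 * d] *)

Lemma pierceable2P d (F : family d) :
  pierceable 2 F <-> exists p q : point d, forall B, F B -> B p \/ B q.
Proof.
split=> [[[|p [|q [|r A]]] [sz pA]]|[p [q pq]]].
- by exists (fun _ => 0), (fun _ => 0) => B /pA[x []].
- by exists p, p => B /pA[x [[<-|[]] Bx]]; left.
- by exists p, q => B /pA[x [[<-|[<-|[]]] Bx]]; [left|right].
- by [].
- by exists [:: p; q]; split=> // B /pq[Bp|Bq]; [exists p|exists q]; split=> //=; tauto.
Qed.

(** Otherwise the corners formed by the slot values along [e] and along its negation would pierce
    [G]: a box missing the first is beaten on some side [e j], one missing the second on some side
    [~~ e k]. *)
Lemma not_pierceable2_bad d (I : Type) (Fs : I -> family d) (c : 'I_d * bool -> I)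
    (G : family d) :
  (forall i, exists C, Fs i C) -> family_of_boxes G -> ~ pierceable 2 G ->
  (forall j s, more_extreme s j (Fs (c (j, s))) G) ->
  forall e : {ffun 'I_d -> bool}, exists B, G B /\ exists j k,
    (exists C, Fs (c (j, e j)) C /\ beats (e j) j C B) /\
    (exists C, Fs (c (k, ~~ e k)) C /\ beats (~~ e k) k C B).
Proof.
move=> ne boxG np ext e; apply: NNPP => no; apply: np; apply/pierceable2P.
have [v hv] := fin_all_exists (fun js : 'I_d * bool => slot_value js.2 js.1 (ne (c js))).
exists (fun j => v (j, e j)), (fun j => v (j, ~~ e j)) => B GB.
rewrite !(is_boxP (boxG _ GB)).
case: (classic (exists j, exists C, Fs (c (j, e j)) C /\ beats (e j) j C B)).
- move=> [j bj]; right=> k; apply: (hv (k, ~~ e k) G) => // bk.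
  by apply: no; exists B; split=> //; exists j, k.
- move=> nj; left=> j; apply: (hv (j, e j) G) => // bj.
  by apply: nj; exists j.
Qed.

Lemma In_mem (T : eqType) (x : T) (s : seq T) : In x s <-> x \in s.
Proof.
elim: s => //= a s IH; rewrite inE; split=> [[->|/IH->]|/orP[/eqP->|/IH]].
- by rewrite eqxx.
- by rewrite orbT.
- by left.
- by right.
Qed.

Lemma hc_property_two_boxes d : (0 < d)%N -> hc_property d 2 (3 * d).
Proof.
move=> d0 Fs boxes col; apply: NNPP => nop.
have np i : ~ pierceable 2 (Fs i) by move=> pi; apply: nop; exists i.
have ne i : exists C, Fs i C := not_pierceable_inhabited (np i).
have i0 : 'I_(3 * d) by exists 0%N; rewrite muln_gt0.
pose slots := enum {: 'I_d * bool}.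
have szs : size slots = (2 * d)%N by rewrite -cardE card_prod card_ord card_bool mulnC.
have [||||c [cinj _ cext]] := @greedy_slots _ _
    (fun (s : 'I_d * bool) i k => more_extreme s.2 s.1 (Fs i) (Fs k)) slots setT i0.
- by move=> s i k; apply: more_extreme_total.
- by move=> s i k l; apply: more_extreme_trans.
- exact: enum_uniq.
- by rewrite szs cardsT card_ord leq_mul2r orbT.
have {}cinj : injective c by move=> s t; apply: cinj; rewrite mem_enum.
pose rs := enum [predC codom c].
have urs : uniq rs := enum_uniq _.
have nrs i : i \in rs = (i \notin codom c) by rewrite mem_enum.
have szr : size rs = d.
  have := cardC (mem (codom c)); rewrite card_codom // card_prod card_ord card_bool card_ord.
  rewrite -cardE (_ : #|[predC codom c]| = #|[predC mem (codom c)]|) // => E.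
  by apply/eqP; rewrite -(eqn_add2l (d * 2)) E mulSn [(2 * d)%N]mulnC addnC.
have ext i j s : i \in rs -> more_extreme s j (Fs (c (j, s))) (Fs i).
  rewrite nrs => ic; apply: (cext (j, s)); rewrite ?inE ?mem_enum //.
pose bt B j s := exists C, Fs (c (j, s)) C /\ beats s j C B.
have [|f [fF bad]] := @rainbow_bad_everywhere d _ _ (fun _ => False)
    (fun i B => Fs i B) bt rs d0 szr urs.
  move=> i e ir.
  exact: (not_pierceable2_bad ne (boxes i) (np i) (fun j s => ext i j s ir) e).
(* In each coordinate a single pair of slot boxes must beat every [f i] that their families beat,
   and be separated if there is such an [f i]. *)
have pick j : exists CD : (point d -> Prop) * (point d -> Prop),
    [/\ Fs (c (j, false)) CD.1, Fs (c (j, true)) CD.2 & forall i s, i \in rs ->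
      bt (f i) j s ->
      beats s j (if s then CD.2 else CD.1) (f i) /\ hi j CD.1 < lo j CD.2].
  have [|i /In_mem ir|C [D [FC FD H]]] :=
    common_separated_pair (lo := lo j) (hi := hi j) (B := f) (rs := rs)
      (ne (c (j, false))) (ne (c (j, true))).
  - move=> i /In_mem ir t ht; apply: (ext i j false ir t); exists (f i); split=> //; exact: fF.
  - move=> t ht; have [|D [FD hD]] := ext i j true ir (- t).
      by exists (f i); split; [exact: fF | rewrite /key; lra].
    by exists D; split=> //; move: hD; rewrite /key; lra.
  exists (C, D); split=> // i s /In_mem/H[Hl Hr].
  by case: s => bi; [apply: Hr | apply: Hl].
have [E hE] := fin_all_exists pick.
pose T i := if [pick s | c s == i] is Some (j, s)
            then (if s then (E j).2 else (E j).1) else f i.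
have Tc j s : T (c (j, s)) = if s then (E j).2 else (E j).1.
  rewrite /T; case: pickP => [[j' s'] /eqP/cinj[-> ->] //|/(_ (j, s))].
  by rewrite eqxx.
have Tr i : i \in rs -> T i = f i.
  rewrite nrs /T => ic; case: pickP => // s /eqP si.
  by rewrite -si codom_f in ic.
have FT i : Fs i (T i).
  rewrite /T; case: pickP => [[j s] /eqP <-|no].
  - by have [] := hE j; case: s.
  - apply: fF; rewrite nrs; apply/negP => /codomP[s si].
    by move: (no s); rewrite si eqxx.
have /pierceable2P[p [q pq]] := col id T (fun _ _ => id) FT.
have TP i : (forall j, lo j (T i) <= p j /\ p j <= hi j (T i)) \/
            (forall j, lo j (T i) <= q j /\ q j <= hi j (T i)).
  rewrite -!(is_boxP (boxes _ _ (FT i))); apply: pq; by exists i.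
(* The diagonal [x] records the side taken by [p]; wherever the slot boxes are separated, [q] is on
   the opposite side. *)
pose x : {ffun 'I_d -> bool} :=
  [ffun j => if Rle_lt_dec (lo j (E j).2) (p j) then true else false].
have side j : hi j (E j).1 < lo j (E j).2 ->
    if x j then lo j (E j).2 <= p j /\ q j <= hi j (E j).1
    else lo j (E j).2 <= q j /\ p j <= hi j (E j).1.
  move=> gap; have := TP (c (j, true)); have := TP (c (j, false)); rewrite !Tc ffunE.
  by case: Rle_lt_dec => cmp [] /(_ j) h1 [] /(_ j) h2; split; lra.
(* The box [f i] that is bad for [x] is missed by [p] at [j] and by [q] at [k]. *)
have [i ir [j [k [bj bk]]]] := bad x.
have [_ _ /(_ i (x j) ir bj) [bj' gj]] := hE j.
have [_ _ /(_ i (~~ x k) ir bk) [bk' gk]] := hE k.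
move: (TP i) (side j gj) (side k gk) bj' bk'; rewrite Tr // /beats.
case=> H; [move: {H} (H j) | move: {H} (H k)]; case: (x j); case: (x k) => /=; lra.
Qed.

(** * Intervals: both bounds *)

Lemma disjoint_not_pierceable d n m (C : 'I_m -> point d -> Prop) (F : family d) :
  (n < m)%N -> (forall i, F (C i)) ->
  (forall i k x, C i x -> C k x -> i = k) -> ~ pierceable n F.
Proof.
move=> nm FC dis [A [szA pA]].
have H i : exists k : 'I_(size A), C i (List.nth k A (fun _ => 0)).
  have [x [Ax Cx]] := pA _ (FC i).
  have [k [/ltP kA kx]] := In_nth _ _ (fun _ => 0) Ax.
  by exists (Ordinal kA); rewrite kx.
have [k hk] := fin_all_exists H.
have inj : injective k by move=> i j ij; apply: dis (hk i) _; rewrite ij.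
by have := leq_card k inj; rewrite !card_ord leqNgt (leq_ltn_trans szA).
Qed.

(** The intervals not beyond the removed colour share the point [v], so adding [v] to a piercing set
    of a restricted family pierces the whole one. Non-pierceability thus survives with one point
    fewer. *)
Lemma rainbow_disjoint_intervals (I : eqType) (rs : seq I) (F : I -> family 1) :
  uniq rs ->
  (forall i, i \in rs -> family_of_boxes (F i) /\ ~ pierceable (size rs).-1 (F i)) ->
  exists f : I -> point 1 -> Prop, (forall i, i \in rs -> F i (f i)) /\
    forall i k x, i \in rs -> k \in rs -> f i x -> f k x -> i = k.
Proof.
have [n] := ubnP (size rs); elim: n rs F => // n IH rs F; rewrite ltnS => szn urs H.
have [rs0|ners] := eqVneq rs [::]; first by exists (fun _ _ => False); rewrite rs0.
have [] := @seq_minimal _ (fun i k => more_extreme false ord0 (F i) (F k)) rs _ _ ners.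
- by move=> i k; apply: more_extreme_total.
- by move=> i k l; apply: more_extreme_trans.
move=> c crs cmin.
have sz0 : (0 < size rs)%N by rewrite lt0n size_eq0.
have szr : size (rem c rs) = (size rs).-1 by rewrite size_rem.
have inr i : (i \in rem c rs) = (i != c) && (i \in rs) by rewrite mem_rem_uniq // inE.
have neF i (ir : i \in rs) : exists C, F i C := not_pierceable_inhabited (proj2 (H i ir)).
pose F' i B := F i B /\ exists C, F c C /\ beats false ord0 C B.
have [v hv] := slot_value false ord0 (neF c crs).
have [|||f [fF fdis]] := IH (rem c rs) F'.
- by rewrite szr prednK.
- exact: rem_uniq.
- move=> i ir; have irs : i \in rs by move: ir; rewrite inr => /andP[].
  have [bi ni] := H i irs; split; first by move=> B [/bi].
  move=> [A [szA pA]]; apply: ni; exists ((fun _ => v) :: A); split.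
    rewrite -szr /=; apply: leq_ltn_trans szA _.
    by rewrite prednK ?leqnn //; case: (rem c rs) ir.
  move=> B FB; case: (classic (exists C, F c C /\ beats false ord0 C B)) => [bB|nB].
    by have [//|x [Ax Bx]] := pA B; exists x; split=> //; right.
  exists (fun _ => v); split; first by left.
  apply/(is_boxP (bi _ FB)) => j; rewrite (ord1 j).
  exact: hv (cmin i irs) FB nB.
(* Only finitely many intervals were chosen, so one interval of colour [c] lies to the left of them
   all. *)
have [C [FC hC]] := common_lower_witness (hi ord0)
  [seq lo ord0 (f i) | i <- rem c rs] (neF c crs).
have below i x : i \in rem c rs -> C x -> f i x -> False.
  move=> ir Cx fx; have [Fi bF] := fF i ir.
  have irs : i \in rs by move: ir; rewrite inr => /andP[].
  have lt : hi ord0 C < lo ord0 (f i).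
    by apply: hC => //; apply: (in_map (fun i => lo ord0 (f i))); apply/In_mem.
  have := proj1 (is_boxP (proj1 (H c crs) _ FC) x) Cx ord0.
  have := proj1 (is_boxP (proj1 (H i irs) _ Fi) x) fx ord0.
  lra.
exists (fun i => if i == c then C else f i); split.
- move=> i irs; case: eqVneq => [-> //|ic].
  by have [|] := fF i; rewrite ?inr ?ic.
- move=> i k x irs krs; case: (eqVneq i c) => [->|ic]; case: (eqVneq k c) => [->|kc] //.
  + by move=> Cx fx; case: (below k x); rewrite ?inr ?kc.
  + by move=> fx Cx; case: (below i x); rewrite ?inr ?ic.
  + by apply: fdis; rewrite inr ?ic ?kc.
Qed.

Lemma hc_property_intervals n : hc_property 1 n n.+1.
Proof.
move=> Fs boxes col; apply: NNPP => nop.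
have np i : ~ pierceable n (Fs i) by move=> pi; apply: nop; exists i.
have [|i _|f [fF fdis]] := @rainbow_disjoint_intervals _ (enum 'I_n.+1) Fs.
- exact: enum_uniq.
- by rewrite -cardE card_ord; split; [exact: boxes | exact: np].
have all i : i \in enum 'I_n.+1 by rewrite mem_enum.
have FT i : Fs i (f i) by exact: fF.
apply: (disjoint_not_pierceable (C := f) (ltnSn n) _ _ (col id f (fun _ _ => id) FT)).
- by move=> i; exists i.
- by move=> i k x; apply: fdis.
Qed.

Lemma not_hc_property_intervals n m : (0 < m)%N -> (m <= n)%N -> ~ hc_property 1 n m.
Proof.
move=> m0 mn H.
pose pt (k : nat) (x : point 1) := x ord0 = INR k.
have [||i] := H (fun _ B => exists k : 'I_n.+1, B = pt k).
- move=> _ _ [k ->]; exists (fun _ => INR k), (fun _ => INR k); split=> [j|x].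
    exact: Rle_refl.
  rewrite /pt; split=> [xk j|/(_ ord0)]; last lra.
  by rewrite (ord1 j) xk; lra.
- move=> idx C _ CF; have [k hk] := fin_all_exists CF.
  exists [seq (fun _ => INR (k j)) | j <- enum 'I_m]; split.
    by rewrite [length _](size_map (fun j _ => INR (k j))) -cardE card_ord.
  move=> _ [j ->]; exists (fun _ => INR (k j)); rewrite hk; split=> //.
  by apply: (in_map (fun j _ => INR (k j))); apply/In_mem; rewrite mem_enum.
- apply: (@disjoint_not_pierceable 1 n n.+1 (fun k => pt k)) => //.
    by move=> k; exists k.
  by move=> k l x; rewrite /pt => -> /INR_eq/val_inj.
Qed.

(** * Two points: strips, the unbalanced cycle and the lower bound *)

Definition cuboid d (a b : point d) : point d -> Prop :=
  fun x => forall j, a j <= x j /\ x j <= b j.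

(** Unlike in [beats], [true] is here the left side. The value 3 separates the sides, and [0, 6]
    contains both. *)
Definition side_lo (s : bool) : R := if s then 1 else 4.
Definition side_hi (s : bool) : R := if s then 2 else 5.

Definition strip d (j : 'I_d) (a b : R) : point d -> Prop :=
  cuboid (fun k => if k == j then a else 0) (fun k => if k == j then b else 6).

(* Whatever one picks from [strip_family j true] and [strip_family j false], both picks
   are hit by some pair of values, one in each of the sides [1, 2] and [4, 5]. *)
Definition strip_family d (j : 'I_d) (s : bool) : family d := fun B =>
  [\/ B = strip j (side_lo s) (side_lo s), B = strip j (side_hi s) (side_hi s) |
      B = strip j (side_lo (~~ s)) (side_hi (~~ s))].

(* The edges [(e, e + 1)] form a cycle on the coordinates; only the closing edge asks
   for opposite sides, so the cycle is unbalanced. *)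
Definition edge_side d (e : 'I_d) (s : bool) : bool := s (+) (e.+1 == d).

Definition edge_box d (e : 'I_d) (s : bool) : point d -> Prop :=
  cuboid
    (fun k => if k == e then side_lo s
              else if k == ordS e then side_lo (edge_side e s) else 0)
    (fun k => if k == e then side_hi s
              else if k == ordS e then side_hi (edge_side e s) else 6).

Definition edge_family d : family d := fun B => exists e s, B = edge_box e s.

Lemma is_box_cuboid d (a b : point d) : (forall j, a j <= b j) -> is_box (cuboid a b).
Proof. by move=> ab; exists a, b. Qed.

Lemma strip_family_boxes d (j : 'I_d) s : family_of_boxes (strip_family j s).
Proof.
by move=> _ [] ->; apply: is_box_cuboid => k; case: s; case: (_ == _) => /=;
  rewrite /side_lo /side_hi; lra.
Qed.

Lemma edge_family_boxes d : family_of_boxes (@edge_family d).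
Proof.
move=> _ [e [s ->]]; apply: is_box_cuboid => k; rewrite /side_lo /side_hi.
by case: (k == e); case: (k == ordS e); case: (edge_side e s); case: s; lra.
Qed.

Lemma strip_family_not_pierceable d (j : 'I_d) s : ~ pierceable 2 (strip_family j s).
Proof.
move=> /pierceable2P[p [q pq]].
have st a b x : strip j a b x -> a <= x j /\ x j <= b by move=> /(_ j); rewrite eqxx.
have h a b : strip_family j s (strip j a b) -> a <= p j <= b \/ a <= q j <= b.
  by move=> /pq[] /st; [left | right].
have := h _ _ (Or31 _ _ erefl); have := h _ _ (Or32 _ _ erefl).
have := h _ _ (Or33 _ _ erefl); rewrite /side_lo /side_hi.
by case: s {h pq} => /=; lra.
Qed.

(** The two boxes of an edge are disjoint, so [q] cannot take both and [p] lies in one. Hence the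
    side of [p] is constant along the cycle until the closing edge reverses it. *)
Lemma edge_family_not_pierceable d : (1 < d)%N -> ~ pierceable 2 (@edge_family d).
Proof.
move=> d1 /pierceable2P[p [q pq]].
pose x (e : 'I_d) : bool := if Rle_lt_dec (p e) 3 then true else false.
have side s (e : 'I_d) : side_lo s <= p e /\ p e <= side_hi s -> x e = s.
  by rewrite /x /side_lo /side_hi; case: s; case: Rle_lt_dec => // ? ?; exfalso; lra.
have step e : x (ordS e) = edge_side e (x e).
  have ne : ordS e == e = false.
    apply/eqP => /(congr1 val) /=; have := ltn_ord e => ed.
    have [E|ne] := eqVneq e.+1 d; first by rewrite E modnn; lia.
    by rewrite modn_small; lia.
  have mem s y : edge_box e s y -> (side_lo s <= y e /\ y e <= side_hi s) /\
      (side_lo (edge_side e s) <= y (ordS e) /\ y (ordS e) <= side_hi (edge_side e s)).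
    by move=> H; move: (H e) (H (ordS e)); rewrite !eqxx ne.
  have [s /mem[/side -> /side ->]] : exists s, edge_box e s p.
    have [|pT|qT] := pq (edge_box e true); [by exists e, true | by exists true |].
    have [|pF|qF] := pq (edge_box e false); [by exists e, false | by exists false |].
    case/mem: qT => T _; case/mem: qF => F _; move: T F; rewrite /side_lo /side_hi; lra.
  by [].
have d0 : (0 < d)%N := ltnW d1.
have const k (kd : (k < d)%N) : x (Ordinal kd) = x (Ordinal d0).
  elim: k kd => [|k IH] kd; first by congr x; apply: val_inj.
  have kd' := ltnW kd.
  rewrite -(IH kd') (_ : Ordinal kd = ordS (Ordinal kd')).
    by rewrite step /edge_side /= (ltn_eqF kd) addbF.
  by apply: val_inj; rewrite /= modn_small.
have kd : (d.-1 < d)%N by rewrite prednK.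
have := step (Ordinal kd); rewrite /edge_side /= prednK // eqxx addbT const.
rewrite (_ : ordS _ = Ordinal d0); last by apply: val_inj; rewrite /= prednK // modnn.
by case: (x _).
Qed.

Definition obstruction_family d (i : nat) : family d := fun B =>
  (exists2 j : 'I_d, i./2 = j & strip_family j (odd i) B) \/
  ((2 * d <= i)%N /\ edge_family B).

Lemma obstruction_family_boxes d i : family_of_boxes (@obstruction_family d i).
Proof.
by move=> B [[j _ /strip_family_boxes]|[_ /edge_family_boxes]].
Qed.

Lemma sub_pierceable d n (F G : family d) :
  (forall B, F B -> G B) -> pierceable n G -> pierceable n F.
Proof. by move=> FG [A [szA pA]]; exists A; split=> // B /FG/pA. Qed.

Lemma obstruction_family_not_pierceable d i :
  (i.+1 < 3 * d)%N -> ~ pierceable 2 (@obstruction_family d i).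
Proof.
move=> i3; case: (ltnP i (2 * d)) => i2 H.
- have id : (i./2 < d)%N by rewrite ltn_half_double -mul2n.
  apply: (@strip_family_not_pierceable d (Ordinal id) (odd i)).
  by apply: sub_pierceable H => B FB; left; exists (Ordinal id).
- apply: (@edge_family_not_pierceable d).
    (* [2 * d <= i] and [i + 1 < 3 * d] force [1 < d]. *)
    by lia.
  by apply: sub_pierceable H => B FB; right.
Qed.

(** At most [d - 1] colours have index [2 * d] or more, too few to name all [d] edges. *)
Lemma missed_edge d m (idx : 'I_m -> 'I_m) (e : 'I_m -> 'I_d) :
  (0 < d)%N -> (m < 3 * d)%N -> injective idx ->
  exists k, forall t, (2 * d <= idx t)%N -> e t != k.
Proof.
move=> d0 m3 inj; apply: NNPP => no.
have H k : exists r : 'I_d.-1, exists2 t, idx t = (2 * d + r)%N :> nat & e t = k.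
  apply: NNPP => nr; apply: no; exists k => t le; apply/eqP => ek; apply: nr.
  have rd : (idx t - 2 * d < d.-1)%N by have := ltn_ord (idx t); lia.
  by exists (Ordinal rd), t => //=; rewrite subnKC.
have [r hr] := fin_all_exists H.
have rinj : injective r.
  move=> k l rkl; have [t tk <-] := hr k; have [u ul <-] := hr l; congr e.
  by apply: inj; apply: val_inj; rewrite /= tk ul rkl.
by have := leq_card r rinj; rewrite !card_ord -ltnS prednK // ltnn.
Qed.

(** Dropping the missed edge [k] opens the cycle, so a consistent choice of sides [eps] exists. The
    two points take opposite sides in every coordinate. *)
Lemma obstruction_colorful_pierceable d m : (0 < d)%N -> (m < 3 * d)%N ->
  colorful_pierceable 2 m (fun i : 'I_m => @obstruction_family d i).
Proof.
move=> d0 m3 idx C inj CF.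
have He t : exists es : 'I_d * bool,
    (2 * d <= idx t)%N -> C t = edge_box es.1 es.2.
  case: (CF t) => [[j jt _]|[_ [e [s ->]]]]; last by exists (e, s).
  by exists (Ordinal d0, true); have := ltn_ord j; lia.
have {He} [es hes] := fin_all_exists He.
have [k hk] := missed_edge (fun t => (es t).1) d0 m3 inj.
(* [w] is the value that the pick from colour [2j + s] prescribes on side [s]; if that pick is the
   whole opposite side, any value on side [s] serves. *)
have Hw (js : 'I_d * bool) : exists w, (side_lo js.2 <= w /\ w <= side_hi js.2) /\
    forall t, idx t = (js.1.*2 + js.2)%N :> nat ->
      C t = strip js.1 w w \/ C t = strip js.1 (side_lo (~~ js.2)) (side_hi (~~ js.2)).
  case: js => j s /=.
  have sle : side_lo s <= side_hi s by rewrite /side_lo /side_hi; case: s; lra.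
  case: (classic (exists t, idx t = (j.*2 + s)%N :> nat)) => [[t ht]|no]; last first.
    by exists (side_lo s); split=> [|t ht]; [lra | case: no; exists t].
  have uq u : idx u = (j.*2 + s)%N :> nat -> u = t.
    by move=> hu; apply: inj; apply: val_inj; rewrite /= ht.
  have : strip_family j s (C t).
    have hj : (idx t)./2 = j.
      rewrite ht halfD odd_double add0n half_double.
      by case: s {sle ht uq}; rewrite ?addn0.
    have hs : odd (idx t) = s by rewrite ht oddD odd_double; case: s {sle ht uq}.
    case: (CF t) => [[j' jj']|[le _]].
      by rewrite hs; suff -> : j' = j by []; apply: val_inj; rewrite /= -jj' hj.
    by have := ltn_ord j; lia.
  case=> Ct; [exists (side_lo s) | exists (side_hi s) | exists (side_lo s)];
    split=> [|u /uq->]; by [lra | left | right].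
have {Hw} [w hw] := fin_all_exists Hw.
(* [eps] changes only across [k] and across the closing edge, where a reversal is required; if [k]
   is the closing edge, [eps] is constant. *)
pose eps (j : 'I_d) := (j <= k)%N.
pose P b j := w (j, eps j (+) b).
have Pin b j : side_lo (eps j (+) b) <= P b j /\ P b j <= side_hi (eps j (+) b).
  by have [] := hw (j, eps j (+) b).
have P06 b j : 0 <= P b j /\ P b j <= 6.
  by have := Pin b j; rewrite /side_lo /side_hi; case: (_ (+) _); lra.
apply/pierceable2P; exists (P false), (P true) => _ [t ->].
suff [b Cb] : exists b, C t (P b) by case: b Cb; [right | left].
case: (CF t) => [[j jt _]|[le _]].
- pose s := odd (idx t).
  have [_ /(_ t)] := hw (j, s); case=> [|->|->] /=.
  + by rewrite -jt addnC -{1}(odd_double_half (idx t)).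
  + exists (eps j (+) s) => l; case: eqP => [->|_]; last exact: P06.
    by rewrite /P addKb; lra.
  + exists (eps j (+) ~~ s) => l; case: eqP => [->|_]; last exact: P06.
    by have := Pin (eps j (+) ~~ s) j; rewrite addKb.
- rewrite (hes t le); have := hk t le; case: (es t) => e s /= ek.
  have epsS : eps (ordS e) = edge_side e (eps e).
    rewrite /edge_side /eps /=; have := ltn_ord e; have := ltn_ord k.
    have nek : e != k :> nat by [].
    have [ed|ned] := eqVneq e.+1 d; first by rewrite ed modnn; lia.
    by move=> _ lt; rewrite modn_small; lia.
  (* The point on side [s] at [e] is, by [epsS], also on the side demanded at [ordS e]. *)
  exists (eps e (+) s) => l; case: eqP => [->|_].
    by have := Pin (eps e (+) s) e; rewrite addKb.
  case: eqP => [->|_]; last exact: P06.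
  have := Pin (eps e (+) s) (ordS e); rewrite epsS /edge_side.
  by case: (eps e); case: (s); case: (_ == d).
Qed.

Lemma not_hc_property_two_boxes d m :
  (0 < d)%N -> (m < 3 * d)%N -> ~ hc_property d 2 m.
Proof.
move=> d0 m3 /(_ _ (fun i => @obstruction_family_boxes d i)
  (obstruction_colorful_pierceable d0 m3)) [i].
by apply: obstruction_family_not_pierceable; apply: leq_ltn_trans (ltn_ord i) m3.
Qed.

Theorem theorem4 :
  (forall n : nat, (1 <= n)%N -> is_hc 1 n n.+1) /\
  (forall d : nat, (1 <= d)%N -> is_hc d 2 (3 * d)).
Proof.
split=> [n n1|d d1]; (split; [|split]).
- by [].
- exact: hc_property_intervals.
- by move=> m m0 mn; apply: not_hc_property_intervals.
- by rewrite muln_gt0.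
- exact: hc_property_two_boxes.
- by move=> m _ m3; apply: not_hc_property_two_boxes.
Qed.
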